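(* Let $n,r$ be positive integers and let $A,B,C$ be nonempty pairwise disjoint subsets of $[n]$ with $A\cup B\cup C=[n]$ and $|C|=r$. Then $$\big[(A\cup B\mid C)\big]_r=\sum_{S\subseteq C}(-1)^{|S|}\big[(A\cup S\mid B\cup(C\setminus S))\big]_r.$$
   Context: An ordered set partition of $[n]$ with $d$ blocks is a sequence $\pi=(\pi_1\mid\cdots\mid\pi_d)$ of nonempty pairwise disjoint subsets of $[n]$ with union $[n]$; $\mathcal{OP}(n,d,r)$ is the set of those with every block of size at least $r$. Let $M=(x_{ij})_{1\le i,j\le n}$ be an $n\times n$ matrix of distinct indeterminates; $M_I^J$ is the determinant of the submatrix with rows $I$ and columns $J$ (both increasing). For $\pi\in\mathcal{OP}(n,d,r)$, an $r$-jellyfish tableau for $\pi$ is an array $T$ with $n-(d-1)r$ rows and $d$ columns, cells empty or containing elements of $[n]$, such that all cells in rows $1,\dots,r$ are nonempty, each row $i>r$ has exactly one nonempty cell, and the nonempty entries of column $j$ are exactly $\pi_j$, increasing downward; $\mathcal{J}_r(\pi)$ is their set. $\mathrm{sgn}(T)=(-1)^{\mathrm{inv}(T)}$, $\mathrm{inv}(T)$ being the number of inversions of the row reading word (rows left to right, top to bottom, empty cells skipped). $\mathrm{J}(T)=\prod_jM^{\pi_j}_{R_j(T)}$ with $R_j(T)$ the set of rows in which column $j$ is nonempty, and the $r$-jellyfish invariant is $[\pi]_r=\sum_{T\in\mathcal{J}_r(\pi)}\mathrm{sgn}(T)\mathrm{J}(T)$. If an ordered set partition has a block of size less than $r$ (or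 an empty block), its $r$-jellyfish invariant is defined to be $0$. *)

(* Defs.v *)
From HB Require Import structures.
From mathcomp Require Import all_boot all_order all_algebra.
From mathcomp Require Export mpoly.

Set Implicit Arguments.
Unset Strict Implicit.
Unset Printing Implicit Defensive.

Import GRing.Theory.
Local Open Scope ring_scope.

(* The set [n] = {1, ..., n} is 'I_n = {0, ..., n-1}; rows and columns of
   matrices and tableaux are also numbered from 0, so "rows 1, ..., r" are the
   i with i < r. *)

Definition generic_mx (R : comNzRingType) (n : nat) : 'M[{mpoly R[n * n]}]_n :=
  \matrix_(i, j) 'X_(mxvec_index i j).

(* M_I^J; enum_val lists the elements of a set in increasing order. Only the
   case #|I| = #|J| is meaningful; the value is 0 otherwise. *)
Definition minor (K : comNzRingType) (n : nat) (M : 'M[K]_n)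
    (I J : {set 'I_n}) : K :=
  if #|I| =P #|J| is ReflectT eqIJ then
    \det (\matrix_(a < #|I|, b < #|I|)
            M (enum_val a) (enum_val (cast_ord eqIJ b)))
  else 0.

Definition inversions (w : seq nat) : nat :=
  \sum_(q < size w) \sum_(p < q) (nth 0 w q < nth 0 w p)%N.

Definition nrows (n d r : nat) : nat := n - d.-1 * r.

Definition tableau (n d r : nat) : finType :=
  'M[option 'I_n]_(nrows n d r, d).

Section Tableau.

Variables (n d r : nat).
Implicit Types (T : tableau n d r) (p : d.-tuple {set 'I_n}).

Definition col_word T (j : 'I_d) : seq 'I_n :=
  pmap (fun i => T i j) (enum 'I_(nrows n d r)).

Definition row_word T : seq 'I_n :=
  flatten [seq pmap (T i) (enum 'I_d) | i <- enum 'I_(nrows n d r)].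

(* enum lists a set of ordinals in increasing order, so the last condition says
   that column j contains exactly the elements of its block, each once,
   increasing downward. *)
Definition is_jellyfish p T : bool :=
  [&& [forall i : 'I_(nrows n d r), (i < r)%N ==> [forall j, T i j != None]],
      [forall i : 'I_(nrows n d r),
         (r <= i)%N ==> (#|[set j | T i j != None]| == 1)%N] &
      [forall j, col_word T j == enum (tnth p j)]].

Definition inv_tableau T : nat := inversions (map val (row_word T)).

(* R_j(T), as a set of row indices of the n x n matrix. *)
Definition occupied_rows T (j : 'I_d) : {set 'I_n} :=
  [set widen_ord (leq_subr _ _) i | i : 'I_(nrows n d r) & T i j != None].

Definition J_poly (K : comNzRingType) (M : 'M[K]_n) p T : K :=
  \prod_(j < d) minor M (occupied_rows T j) (tnth p j).

(* [p]_r, with the convention that it vanishes if a block has fewer than r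
   elements; meant for p an ordered set partition and r > 0. *)
Definition jellyfish_invariant (K : comNzRingType) (M : 'M[K]_n) p : K :=
  if [forall j, (r <= #|tnth p j|)%N] then
    \sum_(T : tableau n d r | is_jellyfish p T)
       (-1) ^+ inv_tableau T * J_poly M p T
  else 0.

End Tableau.

Arguments jellyfish_invariant {n d} r {K} M p.

(* Main.v *)
(** If [2r <= n], expanding the minors turns the invariant of [(P | Q)] into a
    single [n x n] determinant: a tableau, with its two columns permuted
    arbitrarily, is a permutation [w] of [[n]] (its reading word), whose sign is
    [sgn(T)] times those of the column permutations.  The rows of the
    determinant are [x_1|P, x_1|Q, ..., x_r|P, x_r|Q, x_(r+1), ..., x_(n-r)],
    where [x_i|P] is row [i] of [M] with the entries outside [P] replaced by
    [0].  Row operations replace each pair [x_i|P, x_i|Q] by [x_i|Q, x_i], at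
    the cost of a sign [(-1)^r], so only the condition that the set [W] of the
    letters [w(1), w(3), ..., w(2r-1)] lies in [Q] remains.  The theorem then
    holds term by term in [w]: the alternating sum over [S] of the indicators
    of [W <= B u (C \ S)] keeps only the words with [C <= W], that is
    [W = C]. *)

Require Import Defs.
From mathcomp Require Import all_boot all_order all_fingroup all_algebra zify.

Set Implicit Arguments.
Unset Strict Implicit.
Unset Printing Implicit Defensive.

Import Order.TTheory GRing.Theory Num.Theory.
Local Open Scope ring_scope.

(** * Signs of words, determinants and minors *)

(* Both sides are the sign of [det (Vandermonde w) = (-1)^w det (Vandermonde 1)]
   over the integers. *)
Lemma odd_inversions n (w : 'S_n) :
  odd (inversions [seq val (w k) | k <- enum 'I_n]) = w.
Proof.
set s := [seq _ | k <- _].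
have sizes : size s = n by rewrite size_map size_enum_ord.
have nths (i : 'I_n) : nth 0%N s i = w i.
  by rewrite (nth_map i) ?size_enum_ord // nth_ord_enum.
pose V (u : 'S_n) : 'M[int]_n := Vandermonde n (\row_j (u j)%:Z).
have detV : \det (V w) = (-1) ^+ w * \det (V 1%g).
  rewrite -(det_perm _ w) mulrC -[LHS]det_tr -[X in _ = X * _]det_tr mulrC.
  rewrite -det_mulmx -row_permE; congr (\det _).
  by apply/matrixP => i j; rewrite !mxE perm1.
have sgV1 : Num.sg (\det (V 1%g)) = 1.
  rewrite det_Vandermonde gtr0_sg // prodr_gt0 // => i _.
  by rewrite prodr_gt0 // => j ltij; rewrite !mxE !perm1 subr_gt0 ltz_nat.
(* The Vandermonde factor of a pair [i < j] is [w j - w i], which is negative exactly when the pair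
   is an inversion. *)
have sgVw : Num.sg (\det (V w)) = (-1) ^+ inversions s.
  rewrite det_Vandermonde (big_morph _ (@sgrM _) (@sgr1 _)).
  under eq_bigr => i _ do rewrite (big_morph _ (@sgrM _) (@sgr1 _)).
  rewrite /inversions sizes expr_sum (exchange_big_dep xpredT) //=.
  apply: eq_bigr => j _; rewrite expr_sum.
  rewrite [RHS](big_ord_widen n
    (fun p => (-1) ^+ (nth 0%N s j < nth 0%N s p)%N)) //; last exact: ltnW.
  apply: eq_bigr => i ltij; rewrite !mxE !nths.
  have neq : val (w i) != val (w j).
    by apply/negP => /eqP/val_inj/perm_inj eqij; rewrite eqij ltnn in ltij.
  by case: (ltngtP (w i) (w j)) neq => // lt_w _;
    [rewrite gtr0_sg ?subr_gt0 ?ltz_nat | rewrite ltr0_sg ?subr_lt0 ?ltz_nat].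
have := sgVw; rewrite detV sgrM sgV1 mulr1 sgrX sgrN1 -[RHS]signr_odd.
by move=> /(@signr_inj int).
Qed.

Lemma det_reindex (K : comNzRingType) m n (f : 'I_m -> 'I_n) (N : 'M[K]_n) :
  bijective f -> \det (mxsub f f N) = \det N.
Proof.
move=> bij_f; have eqmn: m = n by have := bij_eq_card bij_f; rewrite !card_ord.
subst m; pose s := perm (bij_inj bij_f).
have -> : mxsub f f N = row_perm s (col_perm s N).
  by apply/matrixP => i j; rewrite !mxE !permE.
rewrite row_permE col_permE !det_mulmx !det_perm odd_permV [X in _ * X]mulrC.
by rewrite signrMK.
Qed.

(** Listing the elements of [P] before those of its complement, for rows and columns alike, makes
    [N] block diagonal. *)
Lemma det_split (K : comNzRingType) n (P : {set 'I_n}) (N : 'M[K]_n) :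
  (forall i j, (i \in P) != (j \in P) -> N i j = 0) ->
  \det N =
    \det (\matrix_(a < #|P|, b < #|P|) N (enum_val a) (enum_val b))
    * \det (\matrix_(a < #|~: P|, b < #|~: P|) N (enum_val a) (enum_val b)).
Proof.
move=> N0.
pose f (i : 'I_(#|P| + #|~: P|)) : 'I_n :=
  match split i with inl a => enum_val a | inr b => enum_val b end.
have inP (a : 'I_#|P|) : enum_val a \in P by exact: enum_valP.
have notinP (a : 'I_#|~: P|) : (enum_val a \in P) = false.
  by have := enum_valP a; rewrite inE => /negPf.
have bij_f : bijective f.
  apply: inj_card_bij; last by rewrite !card_ord cardsC card_ord.
  move=> i j; rewrite /f -[i]splitK -[j]splitK !unsplitK.
  case: (split i) (split j) => a [] b =>
    [/enum_val_inj-> // | E | E | /enum_val_inj-> //].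
    by have := notinP b; rewrite -E inP.
  by have := notinP a; rewrite E inP.
rewrite -(det_reindex N bij_f) -[X in \det X]submxK.
have -> : dlsubmx (mxsub f f N) = 0.
  apply/matrixP => a b; rewrite !mxE /f -[rshift _ _]/(unsplit (inr _)).
  rewrite -[lshift _ _]/(unsplit (inl _)) !unsplitK.
  by rewrite N0 // notinP inP.
rewrite det_ublock; congr (_ * _); congr (\det _); apply/matrixP => a b;
  rewrite !mxE /f.
  by rewrite -[lshift _ a]/(unsplit (inl _)) -[lshift _ b]/(unsplit (inl _))
    !unsplitK.
by rewrite -[rshift _ a]/(unsplit (inr _)) -[rshift _ b]/(unsplit (inr _))
  !unsplitK.
Qed.

(** Here [f] is the increasing bijection of [J] onto [I]. Indexing the rows by [J] as well gives the
    minor the shape of a factor in [det_split]. *)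
Lemma minorE (K : comNzRingType) n (M : 'M[K]_n) (I J : {set 'I_n})
    (f : 'I_n -> 'I_n) :
  [seq f j | j <- enum J] = enum I ->
  minor M I J =
    \det (\matrix_(a < #|J|, b < #|J|) M (f (enum_val a)) (enum_val b)).
Proof.
move=> fJI; rewrite /minor; case: eqP => [eqIJ | []]; last first.
  by rewrite !cardE -fJI size_map.
have castE b : (enum_val (cast_ord (esym eqIJ) b) : 'I_n) = f (enum_val b).
  have i0 := enum_val b.
  rewrite !(enum_val_nth i0) -fJI (nth_map i0) //= -cardE; exact: ltn_ord.
rewrite -(@det_reindex _ _ _ (cast_ord eqIJ)); last first.
  by exists (cast_ord (esym eqIJ)) => i; rewrite ?cast_ordK ?cast_ordKV.
congr (\det _); apply/matrixP => a b; rewrite !mxE -castE; congr (M _ _).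
by rewrite cast_ordK.
Qed.

(** * Increasing enumerations of finite sets *)

Lemma map_nth_index (S T : eqType) (x0 : T) (s : seq S) (t : seq T) :
  uniq s -> size s = size t -> [seq nth x0 t (index a s) | a <- s] = t.
Proof.
move=> uniq_s eq_size; apply: (@eq_from_nth _ x0); rewrite size_map // => i lti.
case: s => [|a s] // in uniq_s eq_size lti *.
by rewrite (nth_map a) // index_uniq.
Qed.

Lemma enum_filter (I : finType) (A : {pred I}) :
  enum A = [seq i <- enum I | i \in A].
Proof. by rewrite enumT. Qed.

Lemma pmap_enum (I : finType) (T : Type) (x0 : T) (f : I -> option T) :
  pmap f (enum I) = [seq odflt x0 (f i) | i <- enum [set i | f i]].
Proof.
have -> : enum [set i | f i] = [seq i <- enum I | f i].
  by rewrite enum_filter; apply: eq_filter => i; rewrite inE.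
by elim: (enum I) => //= i s ->; case fi: (f i) => //=; rewrite fi.
Qed.

Lemma ltn_sorted_enum n (A : {set 'I_n}) : sorted ltn [seq val i | i <- enum A].
Proof.
have : sorted ltn [seq val i | i <- enum 'I_n].
  by rewrite val_enum_ord iota_ltn_sorted.
apply: subseq_sorted; first exact: ltn_trans.
by rewrite enum_filter map_subseq // filter_subseq.
Qed.

Lemma enum_widen m n (le_mn : (m <= n)%N) (A : {set 'I_m}) :
  enum [set widen_ord le_mn i | i in A] = [seq widen_ord le_mn i | i <- enum A].
Proof.
apply: (inj_map val_inj); apply: (irr_sorted_eq ltn_trans ltnn).
- exact: ltn_sorted_enum.
- by rewrite -map_comp; exact: ltn_sorted_enum.
move=> x; apply/mapP/mapP => [][y y_in ->]; exists y => //.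
  move: y_in; rewrite mem_enum => /imsetP[i iA ->].
  by rewrite map_f ?mem_enum.
move/mapP: y_in => [i]; rewrite mem_enum => iA ->.
by rewrite mem_enum imset_f.
Qed.

(** * Tableaux with prescribed occupied cells *)

Section FillColumns.

Variables (n d r : nat) (x0 : 'I_n) (p : d.-tuple {set 'I_n}).
Implicit Types (T : tableau n d r) (O : 'I_d -> {set 'I_(nrows n d r)}).

(** When [O j] has the size of block [j], the enumerations of both match and the default [x0] is
    never reached. *)
Definition fill_columns O : tableau n d r :=
  \matrix_(i, j) if i \in O j then
    Some (nth x0 (enum (tnth p j)) (index i (enum (O j)))) else None.

Lemma fill_columns_neq0 O j : [set i | fill_columns O i j != None] = O j.
Proof. by apply/setP => i; rewrite inE mxE; case: (i \in O j). Qed.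

Lemma col_word_fill O j :
  #|O j| = #|tnth p j| -> col_word (fill_columns O) j = enum (tnth p j).
Proof.
move=> eqO; rewrite /col_word (pmap_enum x0).
rewrite -[RHS](@map_nth_index _ _ x0 (enum (O j))).
- under eq_finset => i do rewrite mxE.
  have -> : [set i | if i \in O j
      then Some (nth x0 (enum (tnth p j)) (index i (enum (O j)))) else None]
        = O j.
    by apply/setP => i; rewrite inE; case: (i \in O j).
  by apply/eq_in_map => i; rewrite mem_enum mxE => ->.
- exact: enum_uniq.
- by rewrite -!cardE.
Qed.

Lemma fill_columns_uniq T :
  (forall j, col_word T j = enum (tnth p j)) ->
  T = fill_columns (fun j => [set i | T i j != None]).
Proof.
move=> colT; apply/matrixP => i j; rewrite mxE inE.
have := colT j; rewrite /col_word (pmap_enum x0) => <-.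
have -> : [set i | T i j != None] = [set i | T i j].
  by apply/setP => k; rewrite !inE; case: (T k j).
case Tij : (T i j) => [a|] //=.
have iT : i \in enum [set i | T i j] by rewrite mem_enum inE Tij.
by rewrite (nth_map i) ?index_mem // nth_index // Tij.
Qed.

Lemma card_column T j :
  col_word T j = enum (tnth p j) -> #|[set i | T i j != None]| = #|tnth p j|.
Proof.
move=> colT; rewrite [RHS]cardE -colT /col_word (pmap_enum x0) size_map -cardE.
by apply: eq_card => i; rewrite !inE; case: (T i j).
Qed.

End FillColumns.

(** * Two-column tableaux and their reading words *)

(** The first [r] rows hold two letters each, so position [k] lies in row [k./2], on the left when
    [k] is even. From position [2r] on there is one letter per row, and the row number lags behind
    the position by [r]. *)
Lemma flatten_pairs (T : Type) (a : bool -> nat -> T) (b : nat -> T) n r :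
  (r.*2 <= n)%N ->
  flatten [seq (if (i < r)%N then [:: a true i; a false i] else [:: b i])
            | i <- iota 0 (n - r)]
  = [seq (if (k < r.*2)%N then a (~~ odd k) k./2 else b (k - r)%N)
      | k <- iota 0 n].
Proof.
move=> le_rn.
have -> : (n - r = r + (n - r.*2))%N by lia.
have -> : iota 0 n = iota 0 (r.*2 + (n - r.*2)) by rewrite subnKC.
rewrite !iotaD !map_cat flatten_cat !add0n; congr (_ ++ _).
  have -> : [seq (if (k < r.*2)%N then a (~~ odd k) k./2 else b (k - r)%N)
        | k <- iota 0 r.*2]
      = [seq a (~~ odd k) k./2 | k <- iota 0 r.*2].
    by apply/eq_in_map => k; rewrite mem_iota => /andP[_ ->].
  have -> : [seq (if (i < r)%N then [:: a true i; a false i] else [:: b i])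
        | i <- iota 0 r]
      = [seq [:: a true i; a false i] | i <- iota 0 r].
    by apply/eq_in_map => k; rewrite mem_iota => /andP[_ ->].
  elim: r {le_rn} => // r IHr.
  have -> : r.+1.*2 = (r.*2 + 2)%N by lia.
  have -> : r.+1 = (r + 1)%N by lia.
  rewrite !iotaD !map_cat flatten_cat IHr /= !add0n odd_double /= doubleK.
  by rewrite uphalf_double.
have -> : iota r.*2 (n - r.*2) = [seq (r + i)%N | i <- iota r (n - r.*2)].
  by rewrite -iotaDl addnn.
rewrite -map_comp; set s := iota r _.
have s_ge i : i \in s -> (r <= i)%N by rewrite mem_iota => /andP[].
elim: s s_ge => //= i s IHs s_ge.
rewrite IHs => [|j js]; last by rewrite s_ge // inE js orbT.
have lei : (r <= i)%N by rewrite s_ge // inE eqxx.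
rewrite ltnNge lei /= addKn ifF //; lia.
Qed.

Section TwoColumns.

Variables (K : comNzRingType) (n r : nat) (le2rn : (r.*2 <= n)%N) (x0 : 'I_n).
Variables (M : 'M[K]_n) (P : {set 'I_n}).
Implicit Type X : {set 'I_(nrows n 2 r)}.
Local Notation m := (nrows n 2 r).
Local Notation p := [tuple P; ~: P].

(* The row of the [k]-th cell in reading order: the first [r] rows have two
   cells each, the others one. *)
Definition reading_row (k : nat) : nat :=
  if (k < r.*2)%N then k./2 else (k - r)%N.

Lemma reading_row_lt (k : 'I_n) : (reading_row k < m)%N.
Proof.
by have := ltn_ord k; rewrite /reading_row /nrows mul1n; case: ifP => *; lia.
Qed.

Definition row_of (k : 'I_n) : 'I_m := Ordinal (reading_row_lt k).

Definition block (b : bool) := if b then P else ~: P.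

(** Each row [i >= r] has a single nonempty cell, so the left column [X] alone determines the right
    one. *)
Definition column X (b : bool) : {set 'I_m} :=
  if b then X else [set i : 'I_m | (i < r)%N] :|: ~: X.

(* Whether the [k]-th cell in reading order is in the left column, when [X] is
   the set of rows in which that column is nonempty. *)
Definition left_cell X (k : 'I_n) : bool :=
  if (k < r.*2)%N then ~~ odd k else row_of k \in X.

Definition admissible X : bool :=
  ([set i : 'I_m | (i < r)%N] \subset X) && (#|X| == #|P|).

Definition entry X b (i : 'I_m) : 'I_n :=
  nth x0 (enum (block b)) (index i (enum (column X b))).

Definition tableau_of X : tableau n 2 r :=
  fill_columns x0 p (fun j => column X (j == ord0)).

Lemma tnth_block (j : 'I_2) : tnth p j = block (j == ord0).
Proof. by case: j => [[|[]]]. Qed.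

Lemma low_sub X : [set i : 'I_m | (i < r)%N] \subset X ->
  forall i : 'I_m, (i < r)%N -> i \in X.
Proof. by move=> /subsetP lowX i ltir; rewrite lowX ?inE. Qed.

Lemma card_low : #|[set i : 'I_m | (i < r)%N]| = r.
Proof.
have le_rm : (r <= m)%N by rewrite /nrows mul1n; lia.
have -> : [set i : 'I_m | (i < r)%N] = [set widen_ord le_rm i | i in 'I_r].
  apply/setP => i; rewrite inE; apply/idP/imsetP => [ltir | [j _ ->] /=].
    by exists (Ordinal ltir) => //; apply: val_inj.
  exact: ltn_ord.
by rewrite card_imset ?card_ord // => i j [] /val_inj.
Qed.

(** The right column has [r + (m - #|X|)] cells, and [m = n - r]. *)
Lemma card_column_block X b : admissible X -> #|column X b| = #|block b|.
Proof.
case/andP => lowX /eqP cardX; case: b => //=.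
have := cardsC P; rewrite card_ord -cardX => cardCP.
have := cardsC X; rewrite card_ord => cardCX.
have disj : [disjoint [set i : 'I_m | (i < r)%N] & ~: X].
  by rewrite disjoints_subset setCK.
rewrite cardsU (eqP (_ : _ :&: _ == set0)) ?setI_eq0 //.
rewrite cards0 card_low subn0.
have mE : m = (n - r)%N by rewrite /nrows mul1n.
by move: (#|X|) (#|~: X|) (#|~: P|) cardCP cardCX => a b c; rewrite mE; lia.
Qed.

Lemma is_jellyfish_tableau X : admissible X -> is_jellyfish p (tableau_of X).
Proof.
move=> admX; have /andP[/low_sub lowX _] := admX.
have Tn0 i j : (tableau_of X i j != None) = (i \in column X (j == ord0)).
  by rewrite mxE; case: (i \in _).
apply/and3P; split.
- apply/forallP => i; apply/implyP => ltir; apply/forallP => j.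
  by rewrite Tn0; case: (j == _); rewrite /= ?lowX // !inE ltir.
- apply/forallP => i; apply/implyP => leri; apply/eqP.
  (* Below the first [r] rows, the only nonempty cell is on the left or on the right according to
     whether [i] lies in [X]. *)
  rewrite -[RHS](cards1 (if i \in X then ord0 else ord_max : 'I_2));
    congr #|pred_of_set _|.
  apply/setP => j; rewrite !inE Tn0; case: j => [[|[|//]]] lej /=;
  by rewrite ?inE ?ltnNge ?leri; case: (i \in X).
- apply/forallP => j; apply/eqP/col_word_fill.
  by rewrite tnth_block card_column_block.
Qed.

Definition left_rows (T : tableau n 2 r) : {set 'I_m} :=
  [set i | T i ord0 != None].

Lemma left_rows_tableau X : left_rows (tableau_of X) = X.
Proof. by rewrite /left_rows fill_columns_neq0. Qed.

Lemma jellyfish_classification T : is_jellyfish p T ->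
  admissible (left_rows T) /\ tableau_of (left_rows T) = T.
Proof.
case/and3P => /forallP fullT /forallP oneT /forallP colT.
have {}colT j : col_word T j = enum (tnth p j) by apply/eqP.
split.
  apply/andP; split; last by rewrite (card_column x0 (colT ord0)).
  apply/subsetP => i; rewrite !inE => ltir.
  by have /implyP/(_ ltir)/forallP := fullT i; apply.
rewrite [RHS](fill_columns_uniq x0 colT); apply/matrixP => i j; rewrite !mxE.
suff -> : column (left_rows T) (j == ord0) = [set i | T i j != None] by [].
apply/setP => {}i; case: (altP (j =P ord0)) => [-> // | j_neq0]; rewrite !inE.
have -> : j = ord_max by case: j j_neq0 => [[|[]]] // lej _; apply: val_inj.
have [ltir | leri] := ltnP i r.
  by have /implyP/(_ ltir)/forallP/(_ ord_max) -> := fullT i; rewrite orTb.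
have /implyP/(_ leri)/cards1P[j0 Ej0] := oneT i.
have Tj k : (T i k != None) = (k == j0) by move/setP/(_ k): Ej0; rewrite !inE.
by rewrite /= !Tj; case: j0 {Ej0 Tj} => [[|[|//]]].
Qed.

Lemma sum_jellyfish (F : tableau n 2 r -> K) :
  \sum_(T | is_jellyfish p T) F T = \sum_(X | admissible X) F (tableau_of X).
Proof.
rewrite (reindex_onto tableau_of left_rows) => [|T jT]; last first.
  by case: (jellyfish_classification jT).
apply: eq_bigl => X; rewrite left_rows_tableau eqxx andbT.
apply/idP/idP => [jT | /is_jellyfish_tableau //].
by have [] := jellyfish_classification jT; rewrite left_rows_tableau.
Qed.

Lemma row_of_column X k : admissible X -> row_of k \in column X (left_cell X k).
Proof.
case/andP => /low_sub lowX _; rewrite /left_cell; case: ifP => ltk.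
  have ltr : (row_of k < r)%N by rewrite /= /reading_row ltk; lia.
  by case: (odd k); rewrite /= ?lowX // !inE ltr.
by case E: (row_of k \in X) => //=; rewrite !inE E orbT.
Qed.

Lemma row_of_inj X (k l : 'I_n) :
  left_cell X k = left_cell X l -> row_of k = row_of l -> k = l.
Proof.
rewrite /left_cell => + eqr.
have := congr1 val eqr; rewrite /= /reading_row => eq_row eq_cell.
apply: ord_inj; move: eq_row eq_cell (ltn_ord k) (ltn_ord l).
by case: ifP; case: ifP => *; lia.
Qed.

Definition reading X (k : 'I_n) : 'I_n := entry X (left_cell X k) (row_of k).

Lemma block_in b a : (a \in block b) = ((a \in P) == b).
Proof. by case: b; rewrite /= ?inE; case: (a \in P). Qed.

Lemma index_column X b i : admissible X -> i \in column X b ->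
  (index i (enum (column X b)) < size (enum (block b)))%N.
Proof.
by move=> admX iX; rewrite -cardE -(card_column_block b admX) cardE index_mem
  mem_enum.
Qed.

Lemma entry_in X b i :
  admissible X -> i \in column X b -> (entry X b i \in P) = b.
Proof.
move=> admX iX; apply/eqP; rewrite -block_in -mem_enum mem_nth //.
exact: index_column.
Qed.

(** The row in which the letter [a] stands. For admissible [X] it maps each block increasingly onto
    its column, and so serves as the [f] of [minorE] for both columns at once. *)
Definition entry_row X (a : 'I_n) : 'I_n :=
  nth x0 (enum [set widen_ord (leq_subr _ _) i | i in column X (a \in P)])
    (index a (enum (block (a \in P)))).

Lemma entry_rowK X b i : admissible X -> i \in column X b ->
  entry_row X (entry X b i) = widen_ord (leq_subr _ _) i.
Proof.
move=> admX iX; rewrite /entry_row entry_in // /entry.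
rewrite index_uniq ?enum_uniq //; last exact: index_column.
rewrite enum_widen (nth_map i) ?nth_index ?index_mem ?mem_enum //.
Qed.

Lemma reading_in X k : admissible X -> (reading X k \in P) = left_cell X k.
Proof. by move=> admX; rewrite entry_in ?row_of_column. Qed.

Lemma reading_row_entry X k : admissible X ->
  entry_row X (reading X k) = widen_ord (leq_subr _ _) (row_of k).
Proof. by move=> admX; rewrite entry_rowK ?row_of_column. Qed.

(** A letter determines its column, by membership in [P], and its row, by [entry_row]; the two
    determine the position. *)
Lemma reading_inj X : admissible X -> injective (reading X).
Proof.
move=> admX k l eqkl; apply: (@row_of_inj X).
  by rewrite -!reading_in // eqkl.
have := congr1 (entry_row X) eqkl; rewrite !reading_row_entry
  // => /(congr1 val) /= ?.
exact: val_inj.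
Qed.

Lemma row_word_tableau X : admissible X ->
  row_word (tableau_of X) = [seq reading X k | k <- enum 'I_n].
Proof.
move=> admX; have /andP[/low_sub lowX _] := admX.
(* [flatten_pairs] counts rows by natural numbers; [o] turns these back into elements of ['I_m]. *)
pose o i := insubd (row_of x0) i.
have oK (i : 'I_m) : o i = i by rewrite /o valKd.
have /(_ (fun b i => entry X b (o i)) (fun i => entry X (o i \in X) (o i))) :=
  @flatten_pairs 'I_n _ _ n r le2rn.
have -> : (n - r)%N = m by rewrite /nrows mul1n.
rewrite -val_enum_ord -map_comp => E.
rewrite -(val_enum_ord n) -[in RHS]map_comp in E.
transitivity (flatten [seq
    (if (i < r)%N then [:: entry X true (o i); entry X false (o i)]
     else [:: entry X (o i \in X) (o i)]) | i : 'I_m <- enum 'I_m]); last first.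
  rewrite [LHS]E; apply: eq_map => k /=; rewrite /reading /left_cell.
  case: ifP => ltk; first by congr entry; rewrite -(oK (row_of k)) /=
    /reading_row ltk.
  by rewrite -[in RHS](oK (row_of k)) /= /reading_row ltk.
congr flatten; apply: eq_map => i; rewrite oK.
rewrite enum_ordSl /= enum_ordSl /= enum_ord0 /= !mxE /=.
case: ltnP => [ltir | leri]; first by rewrite lowX // !inE ltir.
by rewrite !inE ltnNge leri /=; case: (i \in X).
Qed.

(** With rows indexed by letters, the two minors are the diagonal blocks of one [n x n] matrix,
    split along [P]. *)
Lemma J_poly_tableau X : admissible X ->
  J_poly M p (tableau_of X) =
  \det (\matrix_(a, j) (M (entry_row X a) j *+ ((a \in P) == (j \in P)))).
Proof.
move=> admX; rewrite /J_poly big_ord_recl big_ord1.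
rewrite (det_split (P := P)); last first.
  by move=> a j; rewrite mxE => /negPf ->.
have occ j : occupied_rows (tableau_of X) j
    = [set widen_ord (leq_subr _ _) i | i in column X (j == ord0)].
  by rewrite /occupied_rows fill_columns_neq0.
have rowsE b : [seq entry_row X a | a <- enum (block b)]
    = enum [set widen_ord (leq_subr (1 * r) n) i | i in column X b].
  rewrite -[RHS](@map_nth_index _ _ x0 (enum (block b))) ?enum_uniq //;
    last first.
    by rewrite enum_widen size_map -!cardE card_column_block.
  by apply/eq_in_map => a; rewrite mem_enum block_in => /eqP <-.
rewrite !occ; congr (_ * _).
  rewrite (minorE M (rowsE true)); congr (\det _); apply/matrixP => a b;
    rewrite !mxE.
  have := enum_valP a; have := enum_valP b; by rewrite /= => -> ->.
rewrite (minorE M (rowsE false)); congr (\det _); apply/matrixP => a b;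
  rewrite !mxE.
have := enum_valP a; have := enum_valP b; by rewrite !inE /= => /negPf->
  /negPf->.
Qed.

End TwoColumns.

(** * The invariant of a two-block partition as one determinant *)

Lemma prod_nat_of_bool (I : finType) (b : I -> bool) :
  (\prod_i b i)%N = [forall i, b i].
Proof.
have [/forallP allb | /forallPn[i /negPf bi]] := boolP [forall i, b i].
  by rewrite big1 // => i _; rewrite allb.
by rewrite (bigD1 i) //= bi.
Qed.

(** The mask [c] is pulled out of each term of the Leibniz formula, so that relations between masked
    determinants can be checked one permutation at a time. *)
Lemma det_mulb (K : comNzRingType) n (G : 'M[K]_n) (c : 'I_n -> 'I_n -> bool) :
  \det (\matrix_(k, j) (G k j *+ c k j))
  = \sum_(w : 'S_n) (-1) ^+ w * (\prod_k G k (w k)) *+ [forall k, c k (w k)].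
Proof.
apply: eq_bigr => w _; rewrite -prod_nat_of_bool -mulrnAr -prodrMn.
by congr (_ * _); apply: eq_bigr => k _; rewrite mxE.
Qed.

Section JellyfishDet.

Variables (K : comNzRingType) (n r : nat) (le2rn : (r.*2 <= n)%N) (x0 : 'I_n).
Variables (M : 'M[K]_n) (P : {set 'I_n}).
Implicit Type X : {set 'I_(nrows n 2 r)}.
Local Notation m := (nrows n 2 r).
Local Notation p := [tuple P; ~: P].

(** Each of the first [r] rows of [M] appears twice in succession, once for each of its two
    cells. *)
Definition stacked_mx : 'M[K]_n :=
  \matrix_(k, j) M (widen_ord (leq_subr _ _) (row_of le2rn k)) j.

(** Listing the letters in reading order turns the rows of the determinant in [J_poly_tableau] into
    rows of [stacked_mx]; the sign of this row permutation is exactly that of the tableau. *)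
Lemma jellyfish_summand X : admissible P X ->
  (-1) ^+ inv_tableau (tableau_of x0 P X) * J_poly M p (tableau_of x0 P X)
  = \det (\matrix_(k, j)
             (stacked_mx k j *+ (left_cell le2rn X k == (j \in P)))).
Proof.
move=> admX; rewrite (J_poly_tableau le2rn) //.
pose w : 'S_n := perm (@reading_inj _ _ le2rn x0 P X admX).
have -> : (-1) ^+ inv_tableau (tableau_of x0 P X) = (-1) ^+ w :> K.
  rewrite -signr_odd /inv_tableau (row_word_tableau le2rn)
    // -map_comp -(odd_inversions w).
  by congr (_ ^+ odd (inversions _)); apply: eq_map => k /=; rewrite permE.
rewrite -det_perm -det_mulmx -row_permE; congr (\det _).
apply/matrixP => k j; rewrite !mxE permE.
by rewrite (reading_row_entry le2rn x0 k admX) (reading_in le2rn x0 k admX).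
Qed.

Lemma row_of_evenP (i : 'I_m) : (i < r)%N ->
  exists2 k : 'I_n, (k < r.*2)%N && ~~ odd k & row_of le2rn k = i.
Proof.
move=> ltir; have ltk : (i.*2 < n)%N by lia.
exists (Ordinal ltk); first by rewrite /= odd_double; lia.
by apply: val_inj; rewrite /= /reading_row ifT; lia.
Qed.

Lemma row_of_tailP (i : 'I_m) : (r <= i)%N ->
  exists2 k : 'I_n, (r.*2 <= k)%N & row_of le2rn k = i.
Proof.
have mE : m = (n - r)%N by rewrite /nrows mul1n.
move=> leri; have ltk : (i + r < n)%N.
  by have := ltn_ord i; rewrite [X in (_ < X)%N]mE; lia.
exists (Ordinal ltk); first by rewrite /=; lia.
by apply: val_inj; rewrite /= /reading_row ifF; lia.
Qed.

Lemma left_cell_inj X Y : admissible P X -> admissible P Y ->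
  left_cell le2rn X =1 left_cell le2rn Y -> X = Y.
Proof.
move=> /andP[/low_sub lowX _] /andP[/low_sub lowY _] eqXY; apply/setP => i.
have [ltir | leri] := ltnP i r; first by rewrite lowX ?lowY.
have [k lek <-] := row_of_tailP leri.
by have := eqXY k; rewrite /left_cell ltnNge lek.
Qed.

Lemma left_cell_exists (w : 'S_n) :
  (forall k : 'I_n, (k < r.*2)%N -> ~~ odd k = (w k \in P)) ->
  exists2 X, admissible P X & forall k, left_cell le2rn X k = (w k \in P).
Proof.
(* [X] collects the rows of the letters in [P]. A row [i >= r] contains one position only, which
   gives [cellX] there. *)
move=> wP; pose X := [set row_of le2rn k | k in w @^-1: P].
have cellX k : left_cell le2rn X k = (w k \in P).
  rewrite /left_cell; case: ifP => [/wP // | lek].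
  apply/imsetP/idP => [[l lP eqkl] | kP]; last by exists k; rewrite ?inE.
  suff -> : k = l by move: lP; rewrite inE.
  have := congr1 val eqkl; rewrite /= /reading_row lek => eq_row.
  by apply: ord_inj; move: eq_row lek; case: ifP; have := ltn_ord k; lia.
exists X => //; apply/andP; split.
  apply/subsetP => i; rewrite inE => /row_of_evenP[k /andP[ltk evk] <-].
  by apply/imset_f; rewrite inE -wP.
rewrite card_in_imset ?card_preimset //; first exact: perm_inj.
by move=> k l; rewrite !inE => kP lP; apply: (row_of_inj (X := X));
  rewrite !cellX kP lP.
Qed.

(** After exchanging the sums, the coefficient of [w] counts the admissible [X] that agree with [w].
    There is exactly one if the first [2r] letters of [w] lie alternately in [P] and outside, and
    none otherwise. *)
Lemma sum_jellyfish_det :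
  \sum_(X | admissible P X)
     \det (\matrix_(k, j)
             (stacked_mx k j *+ (left_cell le2rn X k == (j \in P))))
  = \det (\matrix_(k, j)
             (stacked_mx k j *+ ((k < r.*2)%N ==> (~~ odd k == (j \in P))))).
Proof.
rewrite det_mulb; under eq_bigr => X _ do rewrite det_mulb.
rewrite exchange_big; apply: eq_bigr => w _ /=.
rewrite sumrMnr; congr (_ *+ _).
have [/forallP wP | notwP] :=
    boolP [forall k : 'I_n, (k < r.*2)%N ==> (~~ odd k == (w k \in P))].
  have [|X admX cellX] := @left_cell_exists w.
    by move=> k ltk; have /implyP/(_ ltk)/eqP := wP k.
  rewrite (bigD1 X) //= big1 => [|Y /andP[admY neqYX]].
    by rewrite addn0 (_ : [forall k, _]) //; apply/forallP => k; rewrite cellX.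
  case: forallP => // cellY; case/eqP: neqYX.
  by apply: left_cell_inj => // k; rewrite cellX; apply/eqP.
rewrite big1 // => X admX; case: forallP => // cellX; case/forallPn: notwP => k.
by rewrite negb_imply => /andP[ltk]; have := cellX k;
  rewrite /left_cell ltk => ->.
Qed.

Lemma jellyfish_det :
  jellyfish_invariant r M p
  = \det (\matrix_(k, j)
             (stacked_mx k j *+ ((k < r.*2)%N ==> (~~ odd k == (j \in P))))).
Proof.
rewrite -sum_jellyfish_det /jellyfish_invariant; case: ifPn => [_ | small].
  by rewrite (sum_jellyfish le2rn x0); apply: eq_bigr => X /jellyfish_summand.
(* Both columns contain the first [r] rows, so a block with fewer than [r] elements leaves no
   admissible [X], and the sum agrees with the convention. *)
rewrite big_pred0 // => X; apply/negP => admX; case/negP: small.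
apply/forallP => j; rewrite tnth_block -(card_column_block le2rn _ admX).
rewrite -[X in (X <= _)%N](card_low le2rn); apply/subset_leq_card.
by case/andP: admX => lowX _; case: (j == ord0) => //; exact: subsetUl.
Qed.

End JellyfishDet.

(** * Row operations on the pairs of equal rows *)

(** The rows are first swapped, which gives the sign; the term added to row [j] then contributes the
    determinant of [D], whose rows [i] and [j] coincide. *)
Lemma det_swap_add (K : comNzRingType) n (A B : 'M[K]_n) (i j : 'I_n) :
  i != j -> (forall k, k != i -> k != j -> A k =1 B k) ->
  B i =1 A j -> (forall l, B j l = A i l + A j l) ->
  \det B = - \det A.
Proof.
move=> neqij eqAB Bi Bj.
pose D := \matrix_(k, l) if k == j then A j l else B k l.
have rows k : lift j k != j by rewrite eq_sym neq_lift.
rewrite (@determinant_multilinear _ _ B (xrow i j A) D j 1 1).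
- rewrite [\det D](determinant_alternate neqij) => [|l]; last first.
    by rewrite !mxE eqxx (negPf neqij).
  by rewrite xrowE det_mulmx det_perm odd_tperm neqij mulN1r mulr0 addr0 mul1r.
- by apply/rowP => l; rewrite !mxE tpermR eqxx !mul1r.
- apply/matrixP => k l; rewrite !mxE; case: tpermP => [->|/eqP|].
  + by rewrite Bi.
  + by rewrite (negPf (rows k)).
  by move=> /eqP ni /eqP nj; rewrite eqAB.
by apply/matrixP => k l; rewrite !mxE (negPf (rows k)).
Qed.

(* [N t] below is the matrix in which the first [t] of the [r] pairs of rows
   have been transformed. *)
Lemma det_pairs (K : comNzRingType) n r (G : 'M[K]_n) (P : {set 'I_n}) :
  (r.*2 <= n)%N ->
  (forall k l : 'I_n,
    (k < r.*2)%N -> (l < r.*2)%N -> k./2 = l./2 -> G k =1 G l) ->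
  \det (\matrix_(k, j) (G k j *+ ((k < r.*2)%N ==> (~~ odd k == (j \in P)))))
  = (-1) ^+ r * \det (\matrix_(k, j)
      (G k j *+ ((k < r.*2)%N && ~~ odd k ==> (j \notin P)))).
Proof.
move=> le2rn pairG.
pose c t (k j : 'I_n) := if (k < t.*2)%N then ~~ odd k ==> (j \notin P)
  else (k < r.*2)%N ==> (~~ odd k == (j \in P)).
pose N t := \matrix_(k, j) (G k j *+ c t k j).
have step t : (t < r)%N -> \det (N t.+1) = - \det (N t).
  move=> lttr.
  have lte : (t.*2 < n)%N by lia.
  have lto : (t.*2.+1 < n)%N by lia.
  have h1 : (t.*2 < t.+1.*2)%N by lia.
  have h2 : (t.*2.+1 < t.+1.*2)%N by lia.
  have h3 : (t.*2.+1 < t.*2)%N = false by lia.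
  have h4 : (t.*2 < r.*2)%N by lia.
  have h5 : (t.*2.+1 < r.*2)%N by lia.
  have eqG : G (Ordinal lte) =1 G (Ordinal lto).
    by apply: pairG => //=; lia.
  (* With [x] the common row of [G] and [Q] the complement of [P], the pair [x|P, x|Q] becomes
     [x|Q, x], where [x = x|P + x|Q]. *)
  apply: (@det_swap_add _ _ _ _ (Ordinal lte) (Ordinal lto)).
  - by rewrite -val_eqE /=; lia.
  - move=> k; rewrite -!val_eqE /= => ne no j; rewrite !mxE; congr (_ *+ _).
    by rewrite /c; congr (nat_of_bool (if _ then _ else _)); lia.
  - move=> j; rewrite !mxE eqG /c h1 h3 h5 /= odd_double /=.
    by case: (j \in P).
  move=> j; rewrite !mxE eqG /c ltnn h2 h3 h4 h5 /= odd_double /=.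
  by case: (j \in P); rewrite ?addr0 ?add0r.
have detN t : (t <= r)%N -> \det (N t) = (-1) ^+ t * \det (N 0%N).
  elim: t => [|t IHt] ltr; first by rewrite mul1r.
  by rewrite (step t ltr) (IHt (ltnW ltr)) exprS mulN1r mulNr.
have -> : \matrix_(k, j) (G k j *+ ((k < r.*2)%N ==> (~~ odd k == (j \in P))))
  = N 0%N.
  by [].
have -> : \matrix_(k, j) (G k j *+ ((k < r.*2)%N && ~~ odd k ==> (j \notin P)))
  = N r.
  by apply/matrixP => k j; rewrite !mxE /c; case: (k < r.*2)%N.
by rewrite (detN r) // mulrA -exprMn mulrNN mulr1 expr1n mul1r.
Qed.

(** * Alternating sums over subsets *)

(** Expand a product with factor [-1 + 1] for each [i] in [D] and [0 + 1] for every other [i]: only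
    the subsets of [D] contribute, and any element of [D] makes the product vanish. *)
Lemma sum_sign_subsets (K : comNzRingType) (I : finType) (D : {set I}) :
  \sum_(S : {set I} | S \subset D) (-1) ^+ #|S| = (D == set0)%:R :> K.
Proof.
transitivity (\prod_i ((if i \in D then -1 else 0) + 1) : K).
  rewrite (bigA_distr _ _ (fun i => if i \in D then -1 else 0) (fun=> 1))
    big_mkcond.
  apply: eq_bigr => S _; rewrite -big_mkcond /=;
    case: ifPn => [subSD | /subsetPn[i iS iD]].
    rewrite -prodr_const; apply: eq_bigr => i iS.
    by rewrite (subsetP subSD).
  by rewrite (bigD1 i) //= (negPf iD) mul0r.
have [-> | /set0Pn[i iD]] := altP (D =P set0).
  by rewrite big1 // => i _; rewrite inE add0r.
by rewrite (bigD1 i) //= iD addNr mul0r.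
Qed.

(** If [W] lies in [B :|: C], the condition on [S] becomes [S \subset C :\: W], so the sum is
    nonzero only for [C \subset W], which means [W = C] by cardinality. Otherwise both sides
    vanish. *)
Lemma sum_sign_cover (K : comNzRingType) (I : finType) (B C W : {set I}) :
  [disjoint B & C] -> #|W| = #|C| ->
  \sum_(S : {set I} | S \subset C) (-1) ^+ #|S| *+ (W \subset B :|: (C :\: S))
  = (W \subset C)%:R :> K.
Proof.
move=> disjBC cardW.
have eqC : (W \subset C) = (C \subset W).
  have -> : (W \subset C) = (W == C) by rewrite eqEcard cardW leqnn andbT.
  by rewrite eq_sym eqEcard cardW leqnn andbT.
have equiv (S : {set I}) : S \subset C ->
    (W \subset B :|: (C :\: S)) = (W \subset B :|: C) && (S \subset C :\: W).
  move=> subSC; apply/idP/andP => [subW | [subW subS]].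
    split; first by apply: subset_trans subW _; rewrite setUS // subsetDl.
    apply/subsetP => i iS; rewrite inE (subsetP subSC) // andbT.
    apply/negP => /(subsetP subW); rewrite !inE iS /= orbF => iB.
    by have := subsetP subSC i iS; rewrite (disjointFr disjBC iB).
  apply/subsetP => i iW; have := subsetP subW i iW; rewrite !inE.
  case/orP => [-> // | iC]; rewrite iC andbT; apply/orP; right.
  by apply/negP => /(subsetP subS); rewrite inE iW.
under eq_bigr => S subSC do rewrite equiv //.
case subW: (W \subset B :|: C) => /=; last first.
  rewrite big1 // (_ : W \subset C = false) //.
  by apply: contraFF subW => subWC; apply: subset_trans subWC (subsetUr _ _).
rewrite eqC -setD_eq0 -sum_sign_subsets big_mkcond [RHS]big_mkcond.
apply: eq_bigr => S _; case subS: (S \subset C :\: W); last by case: ifP.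
by rewrite (subset_trans subS) ?subsetDl.
Qed.

(** * The three-block relation *)

Theorem theorem5p5 (R : comNzRingType) (n r : nat) (A B C : {set 'I_n})
    (n_gt0 : (0 < n)%N) (r_gt0 : (0 < r)%N)
    (A_neq0 : A != set0) (B_neq0 : B != set0) (C_neq0 : C != set0)
    (disjAB : [disjoint A & B]) (disjAC : [disjoint A & C])
    (disjBC : [disjoint B & C])
    (coverABC : A :|: B :|: C = [set: 'I_n]) (cardC : #|C| = r) :
  jellyfish_invariant r (generic_mx R n) [tuple A :|: B; C]
  = \sum_(S : {set 'I_n} | S \subset C)
      (-1) ^+ #|S|
      * jellyfish_invariant r (generic_mx R n)
          [tuple A :|: S; B :|: (C :\: S)].
Proof.
set M := generic_mx R n.
have compl (S : {set 'I_n}) : S \subset C -> B :|: (C :\: S) = ~: (A :|: S).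
  move=> subSC; apply/setP => i; have := in_setT i; rewrite -coverABC !inE.
  case iA: (i \in A).
    by rewrite (disjointFr disjAB iA) (disjointFr disjAC iA) andbF.
  case iC: (i \in C); first by rewrite (disjointFl disjBC iC) andbT.
  by rewrite orbF => /= ->; rewrite (contraFF (subsetP subSC i) iC).
have complC : C = ~: (A :|: B).
  apply/setP => i; have := in_setT i; rewrite -coverABC !inE.
  case iC: (i \in C).
    by rewrite (disjointFl disjAC iC) (disjointFl disjBC iC).
  by rewrite orbF => ->.
(* If [n < 2r], two complementary blocks cannot both have [r] elements, so every invariant is zero
   by convention. *)
have [le2rn | ltn2r] := leqP r.*2 n; last first.
  have zero P : jellyfish_invariant r M [tuple P; ~: P] = 0.
    rewrite /jellyfish_invariant ifN //; apply/negP => /forallP big.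
    have := big ord0; have := big ord_max; rewrite !tnth_block /=.
    move=> leCP leP; have := leq_add leP leCP.
    by rewrite cardsC card_ord addnn leqNgt ltn2r.
  rewrite [in X in [tuple _; X]]complC zero big1 // => S subSC.
  by rewrite compl // zero mulr0.
pose x0 := Ordinal n_gt0; pose G := stacked_mx le2rn M.
(* The sign does not depend on [P] and factors out of both sides of the theorem. *)
have invE P : jellyfish_invariant r M [tuple P; ~: P] = (-1) ^+ r *
    \det (\matrix_(k, j)
            (G k j *+ ((k < r.*2)%N && ~~ odd k ==> (j \in ~: P)))).
  rewrite (jellyfish_det le2rn x0) det_pairs //.
    congr (_ * \det _); apply/matrixP => k j; by rewrite !mxE inE.
  (* The two positions of one of the first [r] tableau rows use the same row of [M]. *)
  move=> k l ltk ltl eq_half j; rewrite [LHS]mxE [RHS]mxE; congr (M _ _);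
    apply: val_inj.
  by rewrite /= /reading_row ltk ltl.
have -> : [tuple A :|: B; C] = [tuple A :|: B; ~: (A :|: B)] by rewrite -complC.
rewrite invE -complC.
under eq_bigr => S subSC do rewrite compl // invE -compl // mulrCA.
rewrite -mulr_sumr; congr (_ * _); rewrite det_mulb.
under [RHS]eq_bigr => S _ do rewrite det_mulb mulr_sumr.
rewrite exchange_big; apply: eq_bigr => w _ /=.
(* Counted from 0, these are the [r] positions whose letters are still constrained. Their letters
   form [W]: the left side requires [W \subset C], the summand of [S] requires
   [W \subset B :|: (C :\: S)]. *)
pose evens := [set k : 'I_n | (k < r.*2)%N && ~~ odd k].
have card_evens : #|evens| = r.
  have lt_double (i : 'I_r) : (i.*2 < n)%N by have := ltn_ord i; lia.
  have -> : evens = [set Ordinal (lt_double i) | i in 'I_r].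
    apply/setP => k; rewrite inE; apply/andP/imsetP => [[ltk evk] | [i _
      ->] /=].
      have lti : (k./2 < r)%N by lia.
      by exists (Ordinal lti) => //; apply: val_inj => /=; lia.
    by have := ltn_ord i; split; lia.
  rewrite card_imset ?card_ord // => i j [] /double_inj; exact: val_inj.
pose W := w @: evens.
have cardW : #|W| = #|C| by rewrite card_imset ?card_evens //; exact: perm_inj.
have allW (Q : {set 'I_n}) :
    [forall k : 'I_n, (k < r.*2)%N && ~~ odd k ==> (w k \in Q)] = (W \subset Q).
  apply/forallP/subsetP => [wQ i /imsetP[k] | subW k].
    by rewrite inE => kev ->; have /implyP/(_ kev) := wQ k.
  by apply/implyP => kev; apply: subW; rewrite imset_f // inE.
rewrite allW -mulr_natr -(sum_sign_cover _ disjBC cardW) mulr_sumr.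
by apply: eq_bigr => S _; rewrite allW !mulrnAr mulrC.
Qed.
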